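(* Let $f,g:2^V\to\mathbb{R}$ be submodular functions on a finite ground set $V$, let $v(X)=f(X)-g(X)$ with $v(\emptyset)=0$, and define, for $X\subseteq V$, $$f'(X)=f(X)-\sum_{j\in X}f(j|V\setminus j),\qquad g'(X)=g(X)-\sum_{j\in X}g(j|V\setminus j),\qquad k(X)=\sum_{j\in X}v(j|V\setminus j),$$ so that $v(X)=f'(X)-g'(X)+k(X)$. Then the following two lower bounds on the minimum of $v$ hold: $$\min_{X\subseteq V} v(X)\ \ge\ \min_{X\subseteq V}\big[f'(X)+k(X)\big]-g'(V),$$ $$\min_{X\subseteq V} v(X)\ \ge\ f'(\emptyset)-g'(V)+\sum_{j\in V}\min(k(j),0).$$
   Context: A set function $f:2^V\to\mathbb{R}$ is submodular if $f(S)+f(T)\ge f(S\cup T)+f(S\cap T)$ for all $S,T\subseteq V$. For any set function $w$, $w(A|B)=w(A\cup B)-w(B)$; a singleton $\{j\}$ is written $j$, so $k(j)=v(j|V\setminus j)$. *)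

(* Defs.v *)
From mathcomp Require Import all_boot all_order all_algebra reals.

Set Implicit Arguments.
Unset Strict Implicit.
Unset Printing Implicit Defensive.

Import Order.TTheory GRing.Theory Num.Theory.
Local Open Scope ring_scope.

Definition submodular (R : realType) (V : finType) (f : {set V} -> R) : Prop :=
  forall S T : {set V}, f S + f T >= f (S :|: T) + f (S :&: T).

(* w(A | B) *)
Definition marginal (R : realType) (V : finType) (w : {set V} -> R)
    (A B : {set V}) : R :=
  w (A :|: B) - w B.

(* X |-> \sum_(j in X) w(j | V \ j) *)
Definition modular_part (R : realType) (V : finType) (w : {set V} -> R)
    (X : {set V}) : R :=
  \sum_(j in X) marginal w [set j] ([set: V] :\ j).

(* The seed [w set0] is itself one of the values, so this is the minimum of w
   over all subsets of V. *)
Definition min_over_subsets (R : realType) (V : finType) (w : {set V} -> R) : R :=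
  \big[Num.min/w set0]_(X : {set V}) w X.

(* Main.v *)
(* Subtracting from a submodular w the modular function with weights
   w(j | V \ j) leaves a monotone function: by submodularity the marginal of j
   is smallest at V \ j. Hence g'(X) <= g'(V) and f'(set0) <= f'(X), and
   k(X) is at least the sum of the negative parts of the weights k(j). *)
Require Import Defs.
From mathcomp Require Import all_boot all_order all_algebra reals.
From mathcomp Require Import ring.

Set Implicit Arguments.
Unset Strict Implicit.
Unset Printing Implicit Defensive.

Import Order.TTheory GRing.Theory Num.Theory.
Local Open Scope ring_scope.

Lemma le_min_over_subsets (R : realType) (V : finType) (w : {set V} -> R)
    (c : R) :
  (forall X, c <= w X) -> c <= min_over_subsets w.
Proof. by move=> le_cw; apply: le_bigmin. Qed.

(** Submodularity applied to [[set j] :|: X] and [[set: V] :\ j]: their union is all of [V], and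
    they meet exactly in [X] because [j] lies outside [X]. *)
Lemma submodular_marginal_ge (R : realType) (V : finType) (w : {set V} -> R)
    (X : {set V}) (j : V) :
  submodular w -> j \notin X ->
  marginal w [set j] ([set: V] :\ j) <= marginal w [set j] X.
Proof.
move=> subw jX; rewrite /marginal.
have defU : [set j] :|: X :|: ([set: V] :\ j) = [set j] :|: ([set: V] :\ j).
  by apply/setP=> i; rewrite !inE; case: (i == j) => //=; rewrite orbT.
have defI : ([set j] :|: X) :&: ([set: V] :\ j) = X.
  by apply/setP=> i; rewrite !inE; case: eqVneq => [->|_];
    rewrite ?(negPf jX) //= andbT.
have := subw ([set j] :|: X) ([set: V] :\ j); rewrite defU defI.
by rewrite lerBrDr addrAC lerBlDr.
Qed.

(** Induction on the size of [B :\: A]: elements of [B] are added to [A] one at a time. *)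
Lemma submodular_sub_modular_part_mono (R : realType) (V : finType)
    (w : {set V} -> R) (A B : {set V}) :
  submodular w -> A \subset B ->
  w A - modular_part w A <= w B - modular_part w B.
Proof.
move=> subw; have [n] := ubnP #|B :\: A|.
elim: n A => // n IHn A ltBAn sAB.
have [BA0|[j jBA]] := set_0Vmem (B :\: A).
  by rewrite (_ : A = B) //; apply/eqP; rewrite eqEsubset sAB -setD_eq0 BA0 eqxx.
have /setDP[jB jA] := jBA.
apply: (le_trans _ (IHn (j |: A) _ _)); last by rewrite subUset sub1set jB.
  (* The sums over [A] cancel; what remains compares the marginal of [j] at [[set: V] :\ j] with its
     marginal at [A]. *)
  rewrite /modular_part big_setU1 //= opprD addrA lerD2r lerBrDr addrC -lerBrDr.
  exact: submodular_marginal_ge.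
rewrite -ltnS; apply: leq_trans ltBAn; rewrite ltnS; apply: proper_card.
by rewrite setUC -setDDl properD1.
Qed.

Lemma modular_partB (R : realType) (V : finType) (w u : {set V} -> R)
    (X : {set V}) :
  modular_part (fun Y => w Y - u Y) X = modular_part w X - modular_part u X.
Proof. by rewrite -sumrB; apply: eq_bigr => j _; rewrite /marginal; ring. Qed.

(** Termwise: [j] contributes its weight if it lies in [X] and 0 otherwise, and the minimum is below
    both. *)
Lemma sum_min0_le_modular_part (R : realType) (V : finType)
    (w : {set V} -> R) (X : {set V}) :
  \sum_(j : V) Num.min (modular_part w [set j]) 0 <= modular_part w X.
Proof.
rewrite /modular_part (big_mkcond (fun j => j \in X)); apply: ler_sum => j _.
by rewrite big_set1; case: ifP => _; rewrite ge_min lexx ?orbT.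
Qed.

Theorem theorem5p3 (R : realType) (V : finType) (f g : {set V} -> R) :
  let v := fun X : {set V} => f X - g X in
  let f' := fun X : {set V} => f X - modular_part f X in
  let g' := fun X : {set V} => g X - modular_part g X in
  let k := modular_part v in
  submodular f -> submodular g -> v set0 = 0 ->
  [/\ forall X : {set V}, v X = f' X - g' X + k X,
      min_over_subsets v >=
        min_over_subsets (fun X : {set V} => f' X + k X) - g' [set: V]
    & min_over_subsets v >=
        f' set0 - g' [set: V] + \sum_(j : V) Num.min (k [set j]) 0].
Proof.
move=> v f' g' k subf subg _.
have vE X : v X = f' X - g' X + k X.
  by rewrite /k modular_partB /v /f' /g'; ring.
have g'_le X : g' X <= g' [set: V].
  exact: submodular_sub_modular_part_mono (subsetT X).
have f'_ge X : f' set0 <= f' X.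
  exact: submodular_sub_modular_part_mono (sub0set X).
split=> //; apply: le_min_over_subsets => X; rewrite vE.
  (* First bound: [f' X + k X] is kept together and only [g' X] is replaced by its largest value. *)
  by rewrite addrAC lerB //; exact: bigmin_le.
(* Second bound: [f'], [g'] and [k] are each bounded separately. *)
by apply: lerD; [exact: lerB | exact: sum_min0_le_modular_part].
Qed.
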